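(* Let $q\ge 2$ be an integer and let $\mathfrak Z_q=\mathbb Z/(q\mathbb Z)$. The Diestel-Leader graph $\mathrm{DL}_3(q)=\mathrm{DL}(q,q,q)$ is (isomorphic to) the Cayley graph of the group $\Gamma_3(\mathfrak Z_q)$ of affine matrices $$\begin{pmatrix}t^k(t+1)^m&P\\0&1\end{pmatrix},\qquad k,m\in\mathbb Z,\ P\in\mathfrak Z_q[t^{-1},(t+1)^{-1},t],$$ with respect to the generators $$\begin{pmatrix}t&b\\0&1\end{pmatrix},\quad\begin{pmatrix}t+1&b\\0&1\end{pmatrix},\quad\begin{pmatrix}t^{-1}+1&-b\,t^{-1}\\0&1\end{pmatrix},\qquad b\in\mathfrak Z_q,$$ and their inverses.
   Context: Here $t$ is an indeterminate, and $\mathfrak Z_q[t^{-1},(t+1)^{-1},t]$ consists of all finite sums $\sum_{k,m}a_{k,m}t^k(t+1)^m$ with $k,m\in\mathbb Z$, $a_{k,m}\in\mathfrak Z_q$ (the localization of $\mathfrak Z_q[t]$ at $t$ and $t+1$). For an integer $q\ge 2$, $\mathbb T_q$ is the homogeneous tree in which every vertex has $q+1$ neighbours, with graph metric $d(\cdot,\cdot)$, a fixed origin $o$ and a fixed end $\omega$ (an end is a class of one-sided infinite geodesic rays, two rays being equivalent if their symmetric difference is finite). Let $x\curlywedge y$ be the maximal common ancestor of $x,y$, i.e. the first common vertex of the geodesic rays from $x$ and from $y$ that represent $\omega$. The Busemann function is $\mathfrak h(x)=d(x,x\curlywedge o)-d(o,x\curlywedge o)$. The graph $\mathrm{DL}(q,q,q)$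 has vertex set $\{x_1x_2x_3\in(\mathbb T_q)^3:\ \mathfrak h(x_1)+\mathfrak h(x_2)+\mathfrak h(x_3)=0\}$, and $x_1x_2x_3$, $y_1y_2y_3$ are neighbours iff there are $i\ne j$ such that $x_i\sim y_i$, $x_j\sim y_j$ in $\mathbb T_q$ and $x_k=y_k$ for the remaining index $k$. For a group $\Gamma$ with finite generating set $S=S^{-1}$, the Cayley graph has vertex set $\Gamma$ and edges $[x,y]$ whenever $x^{-1}y\in S$. *)

(* Defs.v *)
From HB Require Import structures.
From mathcomp Require Import all_boot all_order all_algebra generic_quotient.
From mathcomp Require Import boolp classical_sets functions cardinality.
From mathcomp Require Import ring.

Set Implicit Arguments.
Unset Strict Implicit.
Unset Printing Implicit Defensive.

Import Order.TTheory GRing.Theory Num.Theory.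
Local Open Scope ring_scope.
Local Open Scope quotient_scope.

(* The pair (p, (k, m)) stands for p / (t^k (t+1)^m). Since t and t+1 are monic,
   the denominators are not zero divisors even though Z_q[t] need not be a
   domain, so equality of fractions is cross-multiplication. The type 'Z_q is
   Z/qZ only for q >= 2. *)
Section Localization.

Variable q : nat.

Definition den (d : nat * nat) : {poly 'Z_q} := 'X ^+ d.1 * ('X + 1) ^+ d.2.

Local Notation frac := ({poly 'Z_q} * (nat * nat))%type.

Definition dadd (d e : nat * nat) := (d.1 + e.1, d.2 + e.2)%N.

Lemma denD d e : den (dadd d e) = den d * den e.
Proof. by rewrite /den !exprD mulrACA. Qed.

Lemma den0 : den (0, 0)%N = 1.
Proof. by rewrite /den mulr1. Qed.

Lemma den_lreg d : GRing.lreg (den d).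
Proof.
apply: monic_lreg; rewrite rpredM ?monicXn ?rpredX //.
by rewrite -[1]opprK -polyCN monicXsubC.
Qed.

Definition equivl (x y : frac) := x.1 * den y.2 == y.1 * den x.2.

Lemma equivl_refl : reflexive equivl.
Proof. by move=> x; rewrite /equivl. Qed.

Lemma equivl_sym : symmetric equivl.
Proof. by move=> x y; rewrite /equivl eq_sym. Qed.

Lemma equivl_trans : transitive equivl.
Proof.
move=> y x z /eqP xy /eqP yz; apply/eqP; apply: (@den_lreg y.2).
have -> : den y.2 * (x.1 * den z.2) = (x.1 * den y.2) * den z.2 by ring.
by rewrite xy mulrAC yz; ring.
Qed.

Canonical equivl_equiv := EquivRel equivl equivl_refl equivl_sym equivl_trans.

Definition loc := {eq_quot equivl}.

HB.instance Definition _ : EqQuotient _ equivl loc := EqQuotient.on loc.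
HB.instance Definition _ := Choice.on loc.

Lemma equivlE (x y : frac) :
  (x == y %[mod loc]) = (x.1 * den y.2 == y.1 * den x.2).
Proof. by rewrite eqmodE. Qed.

Definition toloc := lift_embed loc (fun p : {poly 'Z_q} => (p, (0, 0)%N) : frac).
Canonical toloc_pi_morph := PiEmbed toloc.

Definition addl_ (x y : frac) : frac :=
  (x.1 * den y.2 + y.1 * den x.2, dadd x.2 y.2).
Definition addl := lift_op2 loc addl_.

Lemma repr_loc (x : frac) :
  (repr (\pi_loc x)).1 * den x.2 = x.1 * den (repr (\pi_loc x)).2.
Proof. by apply/eqP; rewrite -equivlE reprK. Qed.

Lemma pi_addl : {morph \pi_loc : x y / addl_ x y >-> addl x y}.
Proof.
move=> x y; unlock addl; apply/eqmodP; rewrite /= /equivl /addl_ /= !denD.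
have := repr_loc x; have := repr_loc y.
case: (repr _) => [y1 y2]; case: (repr _) => [x1 x2] /=.
case: x y => [a b] [c d] /= ey ex; apply/eqP.
transitivity ((a * den x2) * (den d * den y2) + (c * den y2) * (den b * den x2)).
  by ring.
by rewrite -ex -ey; ring.
Qed.
Canonical pi_addl_morph := PiMorph2 pi_addl.

Definition oppl_ (x : frac) : frac := (- x.1, x.2).
Definition oppl := lift_op1 loc oppl_.

Lemma pi_oppl : {morph \pi_loc : x / oppl_ x >-> oppl x}.
Proof.
move=> x; unlock oppl; apply/eqmodP; rewrite /= /equivl /oppl_ /=.
by rewrite !mulNr repr_loc.
Qed.
Canonical pi_oppl_morph := PiMorph1 pi_oppl.

Definition mull_ (x y : frac) : frac := (x.1 * y.1, dadd x.2 y.2).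
Definition mull := lift_op2 loc mull_.

Lemma pi_mull : {morph \pi_loc : x y / mull_ x y >-> mull x y}.
Proof.
move=> x y; unlock mull; apply/eqmodP; rewrite /= /equivl /mull_ /= !denD.
by rewrite mulrACA -!repr_loc mulrACA.
Qed.
Canonical pi_mull_morph := PiMorph2 pi_mull.

Lemma daddA : associative dadd.
Proof. by move=> x y z; rewrite /dadd /= !addnA. Qed.

Lemma daddC : commutative dadd.
Proof. by move=> x y; rewrite /dadd addnC [(x.2 + _)%N]addnC. Qed.

Lemma dadd0 d : dadd (0, 0)%N d = d.
Proof. by case: d. Qed.

Lemma addlA : associative addl.
Proof.
elim/quotW=> x; elim/quotW=> y; elim/quotW=> z; rewrite !piE /addl_ /=.
by rewrite daddA !denD; congr (\pi_loc (_, _)); ring.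
Qed.

Lemma addlC : commutative addl.
Proof.
by elim/quotW=> x; elim/quotW=> y; rewrite !piE /addl_ addrC daddC.
Qed.

Lemma add0l : left_id (toloc 0) addl.
Proof.
elim/quotW=> x; rewrite !piE /addl_ /= den0 mul0r mulr1 add0r dadd0.
by case: x.
Qed.

Lemma addNl : left_inverse (toloc 0) oppl addl.
Proof.
elim/quotW=> x; apply/eqP; rewrite piE /equivl /addl_ /oppl_ /=.
by rewrite den0 mulr1 mul0r mulNr addNr.
Qed.

HB.instance Definition _ := GRing.isZmodule.Build loc addlA addlC add0l addNl.

Lemma mullA : associative mull.
Proof.
by elim/quotW=> x; elim/quotW=> y; elim/quotW=> z; rewrite !piE /mull_ /= mulrA daddA.
Qed.

Lemma mullC : commutative mull.
Proof.
by elim/quotW=> x; elim/quotW=> y; rewrite !piE /mull_ mulrC daddC.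
Qed.

Lemma mul1l : left_id (toloc 1) mull.
Proof.
by elim/quotW=> x; rewrite !piE /mull_ /= mul1r dadd0; case: x.
Qed.

Lemma mullDl : left_distributive mull addl.
Proof.
elim/quotW=> x; elim/quotW=> y; elim/quotW=> z; apply/eqP.
rewrite !piE /equivl /mull_ /addl_ /= !denD; apply/eqP.
ring.
Qed.

Lemma loc1_neq0 : toloc 1 != toloc 0.
Proof. by rewrite piE /equivl /= den0 !mulr1 oner_neq0. Qed.

HB.instance Definition _ :=
  GRing.Zmodule_isComNzRing.Build loc mullA mullC mul1l mullDl loc1_neq0.

(* Invertibility is decided classically; as usual x^-1 = x off the units. *)
Definition unitl : {pred loc} := fun x => `[< exists y : loc, y * x = 1 >].
Definition invl (x : loc) : loc := xget x [set y : loc | y * x = 1]%classic.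

Lemma mulVl : {in unitl, left_inverse 1 invl *%R}.
Proof.
move=> x /asboolP [y yx1]; rewrite /invl.
by case: xgetP => [z _ //|/(_ y) /=].
Qed.

Lemma unitlP (x y : loc) : y * x = 1 -> unitl x.
Proof. by move=> yx1; apply/asboolP; exists y. Qed.

Lemma invl_out : {in [predC unitl], invl =1 id}.
Proof.
move=> x; rewrite inE => /asboolPn nx; rewrite /invl.
by case: xgetP => [z _ /= zx1|//]; case: nx; exists z.
Qed.

HB.instance Definition _ :=
  GRing.ComNzRing_hasMulInverse.Build loc mulVl unitlP invl_out.

Lemma toloc_is_zmod_morphism : zmod_morphism toloc.
Proof.
move=> p r; unlock toloc.
rewrite -[X in _ = _ + X]pi_oppl -[RHS]pi_addl /addl_ /oppl_ /= den0.
by rewrite !mulr1 dadd0.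
Qed.
HB.instance Definition _ :=
  GRing.isZmodMorphism.Build {poly 'Z_q} loc toloc toloc_is_zmod_morphism.

Lemma toloc_is_monoid_morphism : monoid_morphism toloc.
Proof.
by split=> [//|p r]; unlock toloc; rewrite -[RHS]pi_mull /mull_ /= dadd0.
Qed.
HB.instance Definition _ :=
  GRing.isMonoidMorphism.Build {poly 'Z_q} loc toloc toloc_is_monoid_morphism.

Lemma toloc_inj : injective toloc.
Proof.
move=> p r /eqP; unlock toloc; rewrite equivlE /= den0 !mulr1; exact: eqP.
Qed.

Definition tvar : loc := toloc 'X.
Definition lconst (b : 'Z_q) : loc := toloc b%:P.

Lemma toloc_den_unit d : toloc (den d) \is a GRing.unit.
Proof.
apply/unitrPr; exists (\pi_loc (1, d)); unlock toloc.
rewrite -[LHS]pi_mull -[RHS]/(toloc 1); unlock toloc; apply/eqmodP.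
by rewrite /= /equivl /mull_ /= dadd0 den0 !mulr1 mul1r.
Qed.

Lemma tvar_unit : tvar \is a GRing.unit.
Proof. by have := toloc_den_unit (1, 0)%N; rewrite /den mulr1. Qed.

Lemma tvar1_unit : tvar + 1 \is a GRing.unit.
Proof.
have := toloc_den_unit (0, 1)%N.
by rewrite /den mul1r expr1 rmorphD /= rmorph1.
Qed.

Lemma locP (x : loc) :
  exists p k m, x = toloc p / (tvar ^+ k * (tvar + 1) ^+ m).
Proof.
elim/quotW: x => -[p [k m]]; exists p, k, m.
have -> : tvar ^+ k * (tvar + 1) ^+ m = toloc (den (k, m)).
  by rewrite /den rmorphM !rmorphXn rmorphD rmorph1.
apply: (canRL (mulrK (toloc_den_unit _))); unlock toloc.
rewrite -[LHS]pi_mull; apply/eqmodP.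
by rewrite /= /equivl /mull_ /= daddC dadd0 den0 mulr1.
Qed.

End Localization.

Arguments tvar {q}.

Section AffineGroup.

Variable q : nat.
Local Notation R := (loc q).

Definition affmx (a b : R) : 'M[R]_2 :=
  \matrix_(i, j) if i == 0 then (if j == 0 then a else b) else (i == j)%:R.

Lemma ord2P (P : 'I_2 -> Prop) : P 0 -> P 1 -> forall i, P i.
Proof.
move=> P0 P1 [[|[|//]] lti].
  by rewrite (_ : Ordinal _ = 0) //; apply: val_inj.
by rewrite (_ : Ordinal _ = 1) //; apply: val_inj.
Qed.

Lemma affmxM (a b c d : R) : affmx a b *m affmx c d = affmx (a * c) (a * d + b).
Proof.
apply/matrixP; elim/ord2P; elim/ord2P; rewrite mxE !big_ord_recl big_ord0 !mxE /=.
all: by rewrite ?mulr1 ?mulr0 ?mul0r ?mul1r ?addr0 ?add0r.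
Qed.

Lemma affmx1 : affmx 1 0 = 1%:M.
Proof. by apply/matrixP; elim/ord2P; elim/ord2P; rewrite !mxE. Qed.

Definition tmon (k m : int) : R := tvar ^ k * (tvar + 1) ^ m.

Definition in_Gamma3 : pred 'M[R]_2 :=
  fun A => `[< exists k m P, A = affmx (tmon k m) P >].

Definition Gamma3 := {A : 'M[R]_2 | in_Gamma3 A}.
HB.instance Definition _ := Choice.on Gamma3.
HB.instance Definition _ := SubChoice.on Gamma3.

Lemma tmonD k m k' m' : tmon (k + k') (m + m') = tmon k m * tmon k' m'.
Proof. by rewrite /tmon !exprzDr ?tvar_unit ?tvar1_unit // mulrACA. Qed.

Lemma tmon0 : tmon 0 0 = 1.
Proof. by rewrite /tmon !expr0z mulr1. Qed.

Lemma Gamma3_mul_subproof (x y : Gamma3) : in_Gamma3 (val x *m val y).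
Proof.
have /asboolP[k [m [P ->]]] := valP x; have /asboolP[k' [m' [P' ->]]] := valP y.
apply/asboolP; exists (k + k'), (m + m'), (tmon k m * P' + P).
by rewrite affmxM tmonD.
Qed.

Lemma Gamma3_one_subproof : in_Gamma3 1%:M.
Proof. by apply/asboolP; exists 0, 0, 0; rewrite tmon0 affmx1. Qed.

Lemma affmxV k m P :
  affmx (tmon (- k) (- m)) (- (tmon (- k) (- m) * P)) *m affmx (tmon k m) P = 1%:M.
Proof. by rewrite affmxM -tmonD !addNr tmon0 subrr affmx1. Qed.

Lemma Gamma3_unit (x : Gamma3) : val x \in unitmx.
Proof.
have /asboolP[k [m [P ->]]] := valP x.
by case: (mulmx1_unit (affmxV k m P)).
Qed.

Lemma Gamma3_inv_subproof (x : Gamma3) : in_Gamma3 (invmx (val x)).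
Proof.
have := Gamma3_unit x; have /asboolP[k [m [P ->]]] := valP x => uA; apply/asboolP.
exists (- k), (- m), (- (tmon (- k) (- m) * P)).
by rewrite -[LHS]mul1mx -(affmxV k m P) -mulmxA mulmxV // mulmx1.
Qed.

Definition Gamma3_mul (x y : Gamma3) : Gamma3 := Sub _ (Gamma3_mul_subproof x y).
Definition Gamma3_one : Gamma3 := Sub _ Gamma3_one_subproof.
Definition Gamma3_inv (x : Gamma3) : Gamma3 := Sub _ (Gamma3_inv_subproof x).

Lemma Gamma3_mulA : associative Gamma3_mul.
Proof. by move=> x y z; apply: val_inj; rewrite /= mulmxA. Qed.
Lemma Gamma3_mul1 : left_id Gamma3_one Gamma3_mul.
Proof. by move=> x; apply: val_inj; rewrite /= mul1mx. Qed.
Lemma Gamma3_mulr1 : right_id Gamma3_one Gamma3_mul.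
Proof. by move=> x; apply: val_inj; rewrite /= mulmx1. Qed.
Lemma Gamma3_mulV : left_inverse Gamma3_one Gamma3_inv Gamma3_mul.
Proof. by move=> x; apply: val_inj; rewrite /= mulVmx ?Gamma3_unit. Qed.
Lemma Gamma3_mulVr : right_inverse Gamma3_one Gamma3_inv Gamma3_mul.
Proof. by move=> x; apply: val_inj; rewrite /= mulmxV ?Gamma3_unit. Qed.

HB.instance Definition _ := isGroup.Build Gamma3
  Gamma3_mulA Gamma3_mul1 Gamma3_mulr1 Gamma3_mulV Gamma3_mulVr.

Definition Gamma3_basic_gens : set Gamma3 := [set g | exists b : 'Z_q,
  [\/ val g = affmx tvar (lconst b),
      val g = affmx (tvar + 1) (lconst b)
    | val g = affmx (tvar^-1 + 1) (- (lconst b * tvar^-1))]]%classic.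

Definition Gamma3_gens : set Gamma3 :=
  [set g | Gamma3_basic_gens g \/ Gamma3_basic_gens (g^-1)%g]%classic.

End AffineGroup.

Definition graph_iso (V W : Type) (e : rel V) (f : rel W) :=
  exists2 phi : V -> W, bijective phi & {mono phi : x y / e x y >-> f x y}.

Definition generates (G : groupType) (S : set G) :=
  forall g : G, exists2 s : seq G,
    (forall x, x \in s -> S x) & g = (\prod_(x <- s) x)%g.

Definition sym_gen_set (G : groupType) (S : set G) :=
  [/\ finite_set S, forall x, S x <-> S (x^-1)%g & generates S].

Definition cayley (G : groupType) (S : set G) : rel G :=
  fun x y => (x^-1 * y)%g \in S.

Section Trees.

Variables (V : choiceType) (e : rel V).

Definition homogeneous_tree (q : nat) :=
  [/\ symmetric e /\ irreflexive e,
      forall x y, exists2 p, path e x p & last x p = y,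
      forall c, (2 < size c)%N -> ~ ucycle e c
    & forall x, exists s, [/\ uniq s, size s = q.+1 & s =i e x]].

Local Open Scope classical_set_scope.

Definition walk_len (x y : V) (n : nat) :=
  exists p, [/\ path e x p, last x p = y & size p = n].

(* The length of a shortest walk; the default 0 is never used in a tree. *)
Definition dist (x y : V) : nat :=
  xget 0%N [set n | walk_len x y n /\ forall m, walk_len x y m -> (n <= m)%N].

Definition geodesic_ray (r : nat -> V) :=
  forall m n, (m <= n)%N -> dist (r m) (r n) = (n - m)%N.

Definition ray_equiv (r s : nat -> V) := finite_set (range r `+` range s).

Definition tree_end (w : set (nat -> V)) :=
  exists2 r, geodesic_ray r & w = [set s | geodesic_ray s /\ ray_equiv r s].

Definition first_common (w : set (nat -> V)) (x y z : V) :=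
  exists r s, [/\ w r, w s, r 0%N = x, s 0%N = y &
    exists n, [/\ z = r n, range s z & forall m, (m < n)%N -> ~ range s (r m)]].

(* If w is an end of a tree, first_common w x y has exactly one element. *)
Definition meet (w : set (nat -> V)) (x y : V) : V := xget x (first_common w x y).

Definition busemann (o : V) (w : set (nat -> V)) (x : V) : int :=
  (dist x (meet w x o))%:Z - (dist o (meet w x o))%:Z.

Definition DL3_vertex (o : V) (w : set (nat -> V)) :=
  {x : {ffun 'I_3 -> V} | \sum_i busemann o w (x i) == 0}.

Definition DL3 (o : V) (w : set (nat -> V)) : rel (DL3_vertex o w) :=
  fun x y => [exists i, exists j,
    [&& i != j, e (val x i) (val y i), e (val x j) (val y j) &
     [forall k, (k != i) && (k != j) ==> (val x k == val y k)]]].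

End Trees.

(* Main.v *)
Require Import Defs.
From mathcomp Require Import all_boot all_order all_algebra.
From mathcomp Require Import boolp classical_sets functions cardinality.
From mathcomp Require Import zify ring.

Set Implicit Arguments.
Unset Strict Implicit.
Unset Printing Implicit Defensive.

Import Order.TTheory GRing.Theory Num.Theory.

(** The vertices of the tree at horocyclic level n can be read as the cosets of
    the elements of valuation at least n in the Laurent series over Z/q: a
    vertex of level n has one parent (level n - 1, the neighbour towards the end
    w) and q children (level n + 1), just as a coset lies in one coset one level
    up and splits into q cosets one level down.

    The ring R of the affine group consists of the rational functions over Z/q
    with poles only at the three places t = 0, t = -1 and infinity. Each place i
    gives a decreasing filtration [fil i n] of R by the valuation at i, so each
    of the three trees can be read as the tree of cosets of one filtration.
    Three facts about these filtrations carry the proof, and all use that the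
    difference of t + 1 and t is a unit:
    - [approximation]: if the levels sum to 0, three prescribed cosets, one for
      each place, have a common element (partial fractions);
    - [fil_cap0]: that element is unique, since a function without poles whose
      valuation at infinity is positive is 0;
    - [fil_cap1]: if the levels sum to -1, the elements lying in all three
      filtrations are the q constant multiples of one monomial in t and t + 1.

    The first two say that a vertex of DL(q,q,q), a triple of cosets whose
    levels sum to 0, is the same thing as a pair of levels (k, m) and an
    element P of R, that is, an affine matrix ([code_total], [code_surj],
    [code_fun], [code_inj]). An edge moves to a child in one tree i and to the
    parent in another tree j; the change of P then lies in the filtrations with
    levels lowered by 1 at j, whose sum is -1. The third fact gives q choices,
    and for (i, j) among (0, oo), (-1, oo), (-1, 0) they are exactly the right
    multiplications by the generators of the three families; the opposite pairs
    give their inverses ([basic_arc], [step_code], [DL3_cayley]).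

    On the side of the abstract tree, the geodesic ray in w from each vertex is
    unique, which yields the parent map and its relation to the Busemann
    function ([edge_parent], [busemann_parent]). Siblings are labelled by Z/q so
    that the labels vanish along the ray from o ([sibling_labels]); the labels
    met on the way from w to a vertex are the digits of a center of the coset
    attached to that vertex. *)

(** * Rays of a tree towards a fixed end *)

Section EndedTree.

Variables (V : choiceType) (e : rel V).
Hypotheses (e_sym : symmetric e) (e_irr : irreflexive e).
Hypothesis conn : forall x y, exists2 p, path e x p & last x p = y.
Hypothesis acyc : forall c, (2 < size c)%N -> ~ ucycle e c.

(** If the first edges x a and x b differ, following p and coming back along p'
    gives a walk from a to b that avoids x; shortening it and closing it through
    x gives a simple cycle. *)
Lemma uniq_path_eq x p p' : path e x p -> path e x p' ->
  uniq (x :: p) -> uniq (x :: p') -> last x p = last x p' -> p = p'.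
Proof.
elim: p p' x => [|a p IH] [|b p'] x //=.
- by move=> _ _ _ /andP[/negP nx _] ex; case: nx; rewrite [in X in X \in _]ex mem_last.
- by move=> _ _ /andP[/negP nx _] _ ex; case: nx; rewrite -[in X in X \in _]ex mem_last.
move=> /andP[xa pa] /andP[xb pb] /andP[nx ua] /andP[nx' ub] el.
have [ab|nab] := eqVneq a b.
  by subst b; congr cons; apply: IH el.
exfalso.
have pr : path e (last b p') (rev (belast b p')).
  rewrite rev_path; apply: sub_path pb => u v; by rewrite e_sym.
have pw : path e a (p ++ rev (belast b p')) by rewrite cat_path pa el.
have lw : last a (p ++ rev (belast b p')) = b.
  by rewrite last_cat el; case: (p') => //= c s; rewrite rev_cons last_rcons.
have nw : x \notin a :: p ++ rev (belast b p').
  rewrite -cat_cons mem_cat negb_or nx /= mem_rev.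
  by apply: contra nx' => /mem_belast.
move: lw; case: (shortenP pw) => c pc uc sc lc.
(* a != b leaves c nonempty, so the cycle has length at least 3. *)
apply: (@acyc (x :: a :: c)).
  by case: c pc uc sc lc => //= _ _ _ ab; rewrite ab eqxx in nab.
rewrite /ucycle (cycle_path x) /= lc (e_sym b) xb xa pc /=.
apply/andP; split; last exact: uc.
by apply: contra nw; rewrite !inE => /orP[->//|/sc ->]; rewrite orbT.
Qed.

(** A shortest walk can be shortened to a simple path with the same ends, and
    there is only one. *)
Lemma distE x p : path e x p -> uniq (x :: p) -> dist e x (last x p) = size p.
Proof.
move=> pp up; have short n : walk_len e x (last x p) n -> size p <= n.
  case=> p' [pp' + <-]; case: (shortenP pp') => c pc uc sc lc.
  have -> : p = c by apply: (uniq_path_eq pp pc up uc).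
  by apply: uniq_leq_size sc; case/andP: uc.
have wp : walk_len e x (last x p) (size p) by exists p.
apply: xget_unique => [//|n [/short nn /(_ _ wp) nn']]; lia.
Qed.

Lemma dist_walk x y : walk_len e x y (dist e x y).
Proof.
have [p pp <-] := conn x y; case: (shortenP pp) => c pc uc _.
by rewrite (distE pc uc); exists c.
Qed.

Lemma dist1_edge x y : dist e x y = 1 -> e x y.
Proof.
have := dist_walk x y => -[p [pp <- <-]].
by case: p pp => [|z []] //=; rewrite andbT.
Qed.

Definition nonbacktracking (r : nat -> V) := forall n, e (r n) (r n.+1) /\ r n <> r n.+2.

Definition seg (r : nat -> V) i d := [seq r j | j <- iota i d].

Lemma path_seg r i d : nonbacktracking r -> path e (r i) (seg r i.+1 d).
Proof.
by move=> nbr; elim: d i => //= d IH i; rewrite IH; case: (nbr i) => ->.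
Qed.

Lemma last_seg r i d : last (r i) (seg r i.+1 d) = r (i + d).
Proof. by elim: d i => [|d IH] i /=; rewrite ?addn0 // IH addSnnS. Qed.

(** The first return of a walk to a visited vertex would close a simple cycle:
    its length is neither 1 (no loops) nor 2 (no backtracking). *)
Lemma nonbacktracking_inj r : nonbacktracking r -> injective r.
Proof.
move=> nbr; suff H d i : 0 < d -> r i <> r (i + d).
  move=> i j rij; case: (ltngtP i j) => // ij.
    by case: (H (j - i) i); rewrite ?subn_gt0 // subnKC // ltnW.
  by case: (H (i - j) j); rewrite ?subn_gt0 // subnKC // ltnW.
elim/ltn_ind: d i => d IH i d0 rid.
have [er nr] := nbr i.
have d1 : d != 1.
  by apply/eqP=> d1; move: er; rewrite rid d1 addn1 e_irr.
have d2 : d != 2 by apply/eqP=> d2; apply: nr; rewrite rid d2 addn2.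
apply: (@acyc (seg r i d)); first by rewrite size_map size_iota; lia.
case: d => // d in IH d0 rid d1 d2 *.
apply/andP; split.
  rewrite /= rcons_path -[map _ _]/(seg _ _ _) path_seg // last_seg rid addnS.
  by case: (nbr (i + d)).
rewrite map_inj_in_uniq ?iota_uniq // => j k.
move: (j : nat) (k : nat) => {}j {}k; rewrite !mem_iota => hj hk rjk.
case: (ltngtP j k) => // jk.
  by case: (IH (k - j) _ j); rewrite ?subn_gt0 ?(subnKC (ltnW jk)) //; lia.
by case: (IH (j - k) _ k); rewrite ?subn_gt0 ?(subnKC (ltnW jk)) //; lia.
Qed.

Lemma uniq_seg r i d : nonbacktracking r -> uniq (r i :: seg r i.+1 d).
Proof.
by move=> /nonbacktracking_inj inj; rewrite -[_ :: _]/(seg r i d.+1) map_inj_uniq ?iota_uniq.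
Qed.

Lemma nonbacktracking_dist r i d : nonbacktracking r -> dist e (r i) (r (i + d)) = d.
Proof.
move=> nbr; have := distE (path_seg i d nbr) (uniq_seg i d nbr).
by rewrite last_seg size_map size_iota.
Qed.

(** In a tree being geodesic is a local condition, so rays can be extended and
    truncated step by step. *)
Lemma geodesic_rayP r : geodesic_ray e r <-> nonbacktracking r.
Proof.
split=> [g n|nbr m n mn]; last by rewrite -[in r n](subnKC mn) nonbacktracking_dist.
split; first by apply: dist1_edge; rewrite g // subSnn.
move=> E; have := g n n.+2 (leqW (leqnSn n)).
by rewrite -E (g n n (leqnn n)); lia.
Qed.

(** Rays from the same vertex with arbitrarily late common vertices agree: up to
    such a vertex both are the simple path from the origin. *)
Lemma ray_eq (r s : nat -> V) : nonbacktracking r -> nonbacktracking s -> r 0 = s 0 ->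
  (forall n, exists2 N, n <= N & exists M, r N = s M) -> r = s.
Proof.
move=> nbr nbs rs0 H; apply: funext => n.
have [N nN [M rsNM]] := H n.
have := nonbacktracking_dist 0 N nbr; have := nonbacktracking_dist 0 M nbs.
rewrite !add0n -rsNM -rs0 => -> NM; subst M.
have E : seg r 1 N = seg s 1 N.
  apply: uniq_path_eq (path_seg 0 _ nbr) _ (uniq_seg 0 _ nbr) _ _.
  - by rewrite rs0 path_seg.
  - by rewrite rs0 uniq_seg.
  by rewrite last_seg rs0 last_seg.
case: n nN => // n nN.
have /(congr1 (fun s => nth (r 0) s n)) := E.
by rewrite !(nth_map 0) ?size_iota // nth_iota.
Qed.

Local Open Scope classical_set_scope.

Lemma ray_equiv_meet (r s : nat -> V) : injective r -> ray_equiv r s ->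
  forall n, exists2 N, (n <= N)%N & exists M, r N = s M.
Proof.
move=> rinj rs n; apply: contrapT => H.
have fin : finite_set (r @^-1` (range r `+` range s)).
  by apply: finite_preimage => // x y _ _; apply: rinj.
apply: infinite_nat; have : finite_set (addn n @^-1` (r @^-1` (range r `+` range s))).
  by apply: finite_preimage => // x y _ _; apply: addnI.
apply: sub_finite_set => N _ /=; left; split; first by exists (n + N)%N.
by case=> M _ E; apply: H; exists (n + N)%N; [exact: leq_addr|exists M].
Qed.

Lemma ray_equiv_trans (r s u : nat -> V) :
  ray_equiv r s -> ray_equiv s u -> ray_equiv r u.
Proof.
move=> rs su; apply: (@sub_finite_set _ _ ((range r `+` range s) `|` (range s `+` range u))).
  move=> x /= H; case: (pselect (range s x)) => sx; case: H => -[h1 h2].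
  - by right; left.
  - by left; right.
  - by left; left.
  - by right; right.
by rewrite finite_setU.
Qed.

Lemma ray_equiv_sym (r s : nat -> V) : ray_equiv r s -> ray_equiv s r.
Proof. by apply: sub_finite_set => x /= [] ?; [right|left]. Qed.

Lemma ray_equiv_tail (r s : nat -> V) :
  (forall n, s n.+1 = r n) -> ray_equiv r s.
Proof.
move=> rs; apply: (@sub_finite_set _ _ [set s 0%N]); last exact: finite_set1.
move=> x /= [[[n _ <-] []]|[[[|n] _ <-] // []]].
  by exists n.+1.
by exists n.
Qed.

Variable w : set (nat -> V).
Hypothesis hw : tree_end e w.

Lemma end_nonbacktracking r : w r -> nonbacktracking r.
Proof. by case: hw => r0 _ -> [/geodesic_rayP]. Qed.

Lemma end_meet r s : w r -> w s ->
  forall n, exists2 N, (n <= N)%N & exists M, r N = s M.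
Proof.
move=> wr ws; apply: ray_equiv_meet; first exact/nonbacktracking_inj/end_nonbacktracking.
case: hw wr ws => r0 _ -> [_ r0r] [_ r0s].
by apply: ray_equiv_trans r0s; apply: ray_equiv_sym.
Qed.

Lemma end_ray_inj r s : w r -> w s -> r 0%N = s 0%N -> r = s.
Proof. by move=> wr ws rs; apply: ray_eq (end_meet wr ws); try exact: end_nonbacktracking. Qed.

Lemma end_shift r : w r -> w (fun n => r n.+1).
Proof.
move=> wr; have nbr := end_nonbacktracking wr; case: hw wr => r0 _ -> [gr r0r]; split.
  by apply/geodesic_rayP => n.
by apply: ray_equiv_trans r0r _; apply: ray_equiv_sym; apply: ray_equiv_tail.
Qed.

Definition ray_cons x (r : nat -> V) n := if n is n'.+1 then r n' else x.

Lemma end_cons x r : w r -> e x (r 0%N) -> x <> r 1%N -> w (ray_cons x r).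
Proof.
move=> wr xr xr1; have nbr := end_nonbacktracking wr; case: hw wr => r0 _ -> [gr r0r]; split.
  by apply/geodesic_rayP => -[|n] /=.
by apply: ray_equiv_trans r0r _; apply: ray_equiv_tail.
Qed.

(** Walking from a ray of w to x, each edge either shifts the current ray or
    prolongs it backwards. *)
Lemma end_ray_ex x : exists2 r, w r & r 0%N = x.
Proof.
have [r0 wr0] : exists r, w r.
  by case: hw => r gr ->; exists r; split => //; rewrite /ray_equiv setYK.
have [p pp <-] := conn (r0 0%N) x.
elim/last_ind: p pp => [|p y IH]; first by exists r0.
rewrite rcons_path last_rcons => /andP[/IH[r wr <-] ery].
case: (pselect (y = r 1%N)) => [->|ny].
  by exists (fun n => r n.+1); rewrite //; apply: end_shift.
by exists (ray_cons y r) => //; apply: end_cons; rewrite // e_sym.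
Qed.

Definition ray_to x : nat -> V := sval (cid2 (end_ray_ex x)).
Definition parent x := ray_to x 1.

Lemma ray_to_end x : w (ray_to x).
Proof. by rewrite /ray_to; case: cid2. Qed.

Lemma ray_to0 x : ray_to x 0%N = x.
Proof. by rewrite /ray_to; case: cid2. Qed.

Lemma ray_toE x n : ray_to x n = iter n parent x.
Proof.
elim: n x => [|n IH] x; first exact: ray_to0.
rewrite iterSr -IH.
have -> : ray_to (parent x) = fun n => ray_to x n.+1; last by [].
apply: end_ray_inj; rewrite ?ray_to0 //; first exact: ray_to_end.
by apply: end_shift; apply: ray_to_end.
Qed.

Lemma end_rayE r n : w r -> r n = iter n parent (r 0%N).
Proof.
move=> wr; rewrite -ray_toE; congr (_ n).
by apply: end_ray_inj => //; rewrite ?ray_to0 //; apply: ray_to_end.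
Qed.

Lemma iter_parent_inj x : injective (fun n => iter n parent x).
Proof.
by move=> m n; rewrite -!ray_toE; apply: nonbacktracking_inj; apply/end_nonbacktracking/ray_to_end.
Qed.

(** If y is a neighbour of x other than its parent, the ray from x prolonged
    backwards to y is the ray from y. *)
Lemma edge_parent x y : e x y = (parent x == y) || (parent y == x).
Proof.
have ep z : e z (parent z).
  by have [] := end_nonbacktracking (ray_to_end z) 0; rewrite ray_to0.
apply/idP/orP => [exy|[]/eqP <-]; [|exact: ep|by rewrite e_sym ep].
case: (eqVneq (parent x) y) => [_|/eqP nxy]; [by left|right].
have wr := ray_to_end x.
have wc : w (ray_cons y (ray_to x)).
  by apply: end_cons => //; rewrite ?ray_to0 1?e_sym // => /esym.
by have := end_rayE 1 wc; rewrite /= ray_to0 => <-.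
Qed.

Lemma common_ancestor x y : exists m n, iter m parent x = iter n parent y.
Proof.
have [N _ [M]] := end_meet (ray_to_end x) (ray_to_end y) 0.
by rewrite !ray_toE; exists N, M.
Qed.

Lemma parent_dist x n : dist e x (iter n parent x) = n.
Proof.
have := nonbacktracking_dist 0 n (end_nonbacktracking (ray_to_end x)).
by rewrite add0n !ray_toE.
Qed.

Variable o : V.
Local Notation lev := (busemann e o w).

(** The rays are the iterates of [parent], so the definition of the meet turns
    into a statement on ancestors. *)
Lemma first_commonP x z : first_common w x o z <->
  exists n, [/\ z = iter n parent x, (exists k, z = iter k parent o) &
    forall m k, (m < n)%N -> iter m parent x <> iter k parent o].
Proof.
split=> [[r [s [wr ws <- <- [n [-> [k _ sk] nr]]]]]|[n [-> [k zk] nr]]].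
  exists n; split; [exact: end_rayE| by exists k; rewrite -sk; apply: end_rayE|].
  by move=> m k' mn; rewrite -!end_rayE // => E; apply: (nr m mn); exists k'.
exists (ray_to x), (ray_to o); rewrite !ray_to0; split; try exact: ray_to_end.
  by [].
  by [].
exists n; split; first by rewrite ray_toE.
  by exists k; rewrite // ray_toE.
by move=> m mn [k' _]; rewrite !ray_toE => /esym; apply: nr.
Qed.

(** Any common ancestor of x and o computes the Busemann function: going
    further along the common part of the rays changes both distances alike. *)
Lemma busemannE x i j : iter i parent x = iter j parent o -> lev x = (i%:Z - j%:Z)%R.
Proof.
move=> Eij; rewrite /busemann.
have /first_commonP[n [Ez [k zk] nr]] : first_common w x o (meet w x o).
  apply: xgetPex; have exP : exists n, `[< exists k, iter n parent x = iter k parent o >].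
    by exists i; apply/asboolP; exists j.
  case: (ex_minnP exP) => n /asboolP[k E] nmin; exists (iter n parent x).
  apply/first_commonP; exists n; split=> //; first by exists k.
  move=> m k' mn E'; suff : (n <= m)%N by lia.
  by apply: nmin; apply/asboolP; exists k'.
rewrite {1}Ez zk !parent_dist.
have ni : (n <= i)%N by rewrite leqNgt; apply/negP=> /nr /(_ Eij).
have : iter (i - n + k) parent o = iter j parent o.
  by rewrite iterD -zk Ez -iterD subnK.
by move/iter_parent_inj; lia.
Qed.

Lemma busemann_parent x : (lev (parent x) = lev x - 1)%R.
Proof.
have [i [j E]] := common_ancestor x o.
have E' : iter i parent (parent x) = iter j.+1 parent o by rewrite -iterSr iterS E.
by rewrite (busemannE E) (busemannE E'); lia.
Qed.

End EndedTree.

(** * Vertices of the tree as cosets of a filtration *)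

(** The labels can be chosen to vanish on the ancestors of o because each vertex
    has at most one child among them, which is put first in the list of its
    children. *)
Lemma sibling_labels (V : eqType) (par : V -> V) (o : V) (q : nat) :
    2 <= q -> injective (fun n => iter n par o) ->
    (forall x, exists s, [/\ uniq s, size s = q & forall y, (y \in s) = (par y == x)]) ->
  exists lab : V -> 'Z_q,
    [/\ forall x b, exists2 y, par y = x & lab y = b,
        forall y z, par y = par z -> lab y = lab z -> y = z
      & forall n, lab (iter n par o) = 0%R].
Proof.
move=> q2 inj H.
have {}H x : exists s, [/\ uniq s, size s = q, forall y, (y \in s) = (par y == x)
    & forall n, x = iter n.+1 par o -> nth x s 0 = iter n par o].
  have [s [us ss es]] := H x.
  case: (pselect (exists n, x = iter n.+1 par o)) => [[n xn]|no]; last first.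
    by exists s; split => // n xn; case: no; exists n.
  set z := iter n par o; have zs : z \in s by rewrite es xn eqxx.
  have pz := perm_to_rem zs; exists (z :: rem z s); split.
  - by rewrite -(perm_uniq pz).
  - by rewrite -(perm_size pz).
  - by move=> y; rewrite -(perm_mem pz).
  by move=> n' /= E; have /(inj n.+1 n'.+1) [<-] := etrans (esym xn) E.
have [ch {}H] := choice H.
have idx y : index y (ch (par y)) < q.
  by have [us <- es _] := H (par y); rewrite index_mem es.
have Zq (b : 'Z_q) : b < q by have := ltn_ord b; rewrite [X in _ < X]Zp_cast.
exists (fun y => inZp (index y (ch (par y)))); split.
- move=> x b; have [us ss es _] := H x; have bs : b < size (ch x) by rewrite ss.
  have py : par (nth x (ch x) b) = x by apply/eqP; rewrite -es mem_nth.
  by exists (nth x (ch x) b); rewrite ?py // index_uniq // valZpK.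
- move=> y z pyz /(congr1 val) /=; have := idx y; have := idx z.
  rewrite [Zp_trunc q]/Zp_trunc -[X in _ %% X]/((Zp_trunc q).+2) Zp_cast // => iz iy.
  rewrite !modn_small // -pyz in iz *; apply: (index_inj o).
  by have [_ _ -> _] := H (par y); rewrite eqxx.
  by have [_ _ -> _] := H (par y); rewrite pyz eqxx.
move=> n; have [us ss es /(_ n) /= E] := H (par (iter n par o)).
have -> : index (iter n par o) (ch (par (iter n par o))) = 0.
  move: (E erefl) ss q2.
  by case: (ch _) => [_ <- //|c s /= -> _ _] /=; rewrite eqxx.
exact: val_inj.
Qed.

(** Let A be a decreasing exhaustive filtration of a group R by subgroups in which
    each coset of A n splits into cosets of A (n + 1) along the digits
    [dig n b], with b in Z/q. Then the vertices of level n correspond to the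
    cosets of A n, compatibly with the parent map. *)
Section Balls.

Variables (q : nat) (V : eqType) (par : V -> V) (lev : V -> int) (lab : V -> 'Z_q).
Variable o : V.
Hypothesis lev_par : forall x, lev (par x) = (lev x - 1)%R.
Hypothesis common : forall x y, exists m n, iter m par x = iter n par y.
Hypothesis lab_surj : forall x b, exists2 y, par y = x & lab y = b.
Hypothesis lab_inj : forall y z, par y = par z -> lab y = lab z -> y = z.
Hypothesis lab_ray : forall n, lab (iter n par o) = 0%R.

Local Open Scope ring_scope.

Variables (R : zmodType) (A : int -> R -> Prop) (dig : int -> 'Z_q -> R).
Hypothesis A0 : forall n, A n 0.
Hypothesis AB : forall n P Q, A n P -> A n Q -> A n (P - Q).
Hypothesis Adecr : forall n P, A (n + 1) P -> A n P.
Hypothesis Aexh : forall P, exists n, A n P.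
Hypothesis dig0 : forall n, dig n 0 = 0.
Hypothesis digA : forall n b, A n (dig n b).
Hypothesis dig_surj : forall n P, A n P -> exists b, A (n + 1) (P - dig n b).
Hypothesis dig_inj : forall n b b', A (n + 1) (dig n b - dig n b') -> b = b'.

Let AN n P : A n P -> A n (- P).
Proof. by move=> h; rewrite -sub0r; apply: AB. Qed.
Let AD n P Q : A n P -> A n Q -> A n (P + Q).
Proof. by move=> h /AN /(AB h); rewrite opprK. Qed.

Lemma A_le n m P : m <= n -> A n P -> A m P.
Proof.
move=> mn; have [k ->] : exists k : nat, n = m + k%:Z by exists `|n - m|%N; lia.
elim: k => [|k IH]; first by rewrite addr0.
by move=> h; apply/IH/Adecr; have -> : m + k%:Z + 1 = m + k.+1%:Z by lia.
Qed.

Lemma lev_iter n x : lev (iter n par x) = lev x - n%:Z.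
Proof. by elim: n => [|n IH]; rewrite ?subr0 //= lev_par IH; lia. Qed.

Lemma lab_eventually x : exists N, forall j, (N <= j)%N -> lab (iter j par x) = 0.
Proof.
have [m [n E]] := common x o; exists m => j mj.
by rewrite -(subnK mj) iterD E -iterD.
Qed.

Let depth x := sval (cid (lab_eventually x)).

(** The expansion whose digit at level lev x - 1 - j is the label of the j-th
    ancestor of x; it is a finite sum as labels eventually vanish. *)
Definition center x : R :=
  \sum_(0 <= j < depth x) dig (lev x - j.+1%:Z) (lab (iter j par x)).

Lemma centerE x N : (forall j, (N <= j)%N -> lab (iter j par x) = 0) ->
  center x = \sum_(0 <= j < N) dig (lev x - j.+1%:Z) (lab (iter j par x)).
Proof.
rewrite /center; have := svalP (cid (lab_eventually x)); rewrite -/(depth x).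
move: (depth x) => M; wlog MN : M N / (M <= N)%N => [H hM hN|hM hN].
  by case: (leqP M N) => MN; [apply: H|symmetry; apply: H => //; apply: ltnW].
rewrite [RHS](@big_cat_nat _ _ _ M) //= [X in _ = _ + X]big1_seq ?addr0 //.
by move=> j /=; rewrite mem_index_iota => /andP[Mj _]; rewrite hM ?dig0.
Qed.

Lemma center_par x : center x = center (par x) + dig (lev x - 1) (lab x).
Proof.
have [N HN] := lab_eventually x.
rewrite (@centerE x N.+1); last by move=> j /ltnW; apply: HN.
rewrite (@centerE (par x) N); last by move=> j Nj; rewrite -iterSr HN // leqW.
rewrite big_nat_recl //= addrC; congr (_ + _).
by apply: eq_bigr => j _; rewrite lev_par -iterSr /=; congr (dig _ _); lia.
Qed.

Lemma center_ray n : center (iter n par o) = 0.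
Proof. by rewrite (@centerE _ 0) ?big_nil // => j _; rewrite -iterD lab_ray. Qed.

Definition ball x P := A (lev x) (P - center x).

Lemma ball_center x : ball x (center x).
Proof. by rewrite /ball subrr. Qed.

Lemma ballE x P Q : ball x P -> ball x Q <-> A (lev x) (P - Q).
Proof.
move=> xP; split=> h.
  by have := AB xP h; rewrite opprB addrA subrK.
by have := AB xP h; rewrite /ball opprB addrC addrA subrK.
Qed.

Lemma ball_par x P : ball x P -> ball (par x) P.
Proof.
rewrite /ball lev_par center_par => h.
have {}h : A (lev x - 1) (P - (center (par x) + dig (lev x - 1) (lab x))).
  by apply: A_le h; lia.
by have := AD h (digA (lev x - 1) (lab x)); rewrite opprD addrA subrK.
Qed.

(** By induction from a common ancestor: the parents agree, and the labels
    agree as the corresponding digits lie in the same coset. *)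
Lemma ball_inj x y P : lev x = lev y -> ball x P -> ball y P -> x = y.
Proof.
have [m [n E]] := common x y => lxy.
have mn : m = n by have := congr1 lev E; rewrite !lev_iter; lia.
subst n; elim: m x y lxy E => [//|m IH] x y lxy E bx by_.
have pxy : par x = par y.
  apply: IH; rewrite ?lev_par ?lxy -?iterSr //; exact: ball_par.
apply: lab_inj => //; apply: (@dig_inj (lev x - 1)).
have D (a b c : R) : (a - b) - (a - c) = c - b by rewrite opprB addrC addrA subrK.
have D' (a b c : R) : (a + b) - (a + c) = b - c by rewrite opprD addrACA subrr add0r.
rewrite subrK -(D' (center (par x))) -center_par {2}lxy pxy -center_par -(D P).
by apply: AB => //; rewrite lxy.
Qed.

(** Far towards the end, the ball of an ancestor of o is the subgroup A n itself
    and contains P; from there one descends choosing each digit of P. *)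
Lemma ball_ex n P : exists2 x, lev x = n & ball x P.
Proof.
have [n0 hn0] := Aexh P.
(* The level of this ancestor of o is at most n0, so A contains P there. *)
pose N := `|Num.min n0 n - lev o|%N.
have {hn0} [x lx bx] : exists2 x, lev x <= n & ball x P.
  exists (iter N par o); rewrite /ball ?center_ray ?subr0 ?lev_iter /N; first by lia.
  by apply: A_le hn0; lia.
have [k kE] : exists k : nat, n = lev x + k%:Z by exists `|n - lev x|%N; lia.
clear N; elim: k n kE {lx} => [|k IH] n kE; first by exists x; rewrite // kE addr0.
have [y ly by_] := IH (n - 1) ltac:(lia).
have [b hb] := dig_surj by_.
have [z pz lz] := lab_surj y b.
have levz : lev z = n by have := lev_par z; rewrite pz ly; lia.
exists z => //; rewrite /ball center_par pz lz levz opprD addrA.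
by move: hb; rewrite ly subrK.
Qed.

End Balls.

Local Open Scope ring_scope.

(** * The three valuations of the localization *)

Lemma bezout_exp (R : comPzRingType) (x y u v : R) (a b : nat) :
  u * x + v * y = 1 -> exists u' v', u' * x ^+ a + v' * y ^+ b = 1.
Proof.
move=> uv.
suff step (x' : R) n : (exists u' v', u' * x' + v' * y = 1) ->
    exists u' v', u' * x' + v' * y ^+ n = 1.
  have [u' [v' uv']] : exists u' v', u' * y + v' * x ^+ a = 1.
    elim: a => [|a [u' [v' uv']]]; first by exists 0, 1; rewrite mul0r add0r mulr1.
    exists (u' * u * x + v' * x ^+ a * v + u' * v * y), (v' * u).
    rewrite -[RHS]mulr1 -{1}uv' -uv exprS; ring.
  by apply: step; exists v', u'; rewrite addrC.
case=> u' [v' uv']; elim: n => [|n [u2 [v2 uv2]]].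
  by exists 0, 1; rewrite mul0r add0r mulr1.
exists (u' * u2 * x' + v' * y * u2 + u' * v2 * y ^+ n), (v' * v2).
rewrite -[RHS]mulr1 -{1}uv' -uv2 exprS; ring.
Qed.

Section Filtrations.

Variable q : nat.
Local Notation R := (loc q).
Local Notation tmon := (tmon q).
Local Notation den := (den q).

Implicit Types (P Q : R) (k m n : int) (p : {poly 'Z_q}).

Lemma tmon_den (a b : nat) : tmon a b = toloc (den (a, b)).
Proof. by rewrite /tmon /den rmorphM !rmorphXn rmorphD rmorph1. Qed.

Lemma tmonMA k m k' m' P :
  tmon k m * (tmon k' m' * P) = tmon (k + k') (m + m') * P.
Proof. by rewrite mulrA -tmonD. Qed.

Lemma tmon_unit k m : tmon k m \is a GRing.unit.
Proof.
apply/unitrPr; exists (tmon (- k) (- m)).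
by rewrite -tmonD !addrN tmon0.
Qed.

Lemma toloc_tmonI k m p r : tmon k m * toloc p = tmon k m * toloc r -> p = r.
Proof. by move/(mulrI (tmon_unit k m))/toloc_inj. Qed.

Lemma den_monic d : den d \is monic.
Proof.
by rewrite rpredM ?monicXn ?rpredX // -[1]opprK -polyCN monicXsubC.
Qed.

Lemma size_den d : size (den d) = (d.1 + d.2).+1.
Proof.
rewrite size_Mmonic ?monicXn ?rpredX //; last 2 first.
- by rewrite -size_poly_eq0 size_polyXn.
- by rewrite -[1]opprK -polyCN monicXsubC.
rewrite size_polyXn -[1]opprK -polyCN size_exp_XsubC; lia.
Qed.

Lemma size_mul_den p d : p != 0 -> size (p * den d) = (size p + (d.1 + d.2))%N.
Proof. by move=> p0; rewrite size_Mmonic ?den_monic // size_den addnS. Qed.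

Lemma toloc_denM p (a b : nat) : toloc (p * den (a, b)) = tmon a b * toloc p.
Proof. by rewrite rmorphM /= -tmon_den mulrC. Qed.

(** Lowering exponents is what brings several elements to a common
    denominator. *)
Lemma tmon_lower k m p k' m' : k' <= k -> m' <= m ->
  tmon k m * toloc p = tmon k' m' * toloc (p * den (`|k - k'|%N, `|m - m'|%N)).
Proof.
move=> hk hm; rewrite toloc_denM tmonMA.
by congr (tmon _ _ * _); lia.
Qed.

(** The places 0, 1 and 2 are t = 0, t = -1 and infinity. At the first two the
    condition is that the valuation of P be at least n; at infinity, where the
    valuation is minus the degree, it is that the degree of P be less than - n
    ([size p] is one more than the degree of p). The strict inequality makes
    the three levels of a vertex sum to 0. *)
Definition fil (i : 'I_3) n P : Prop :=
  match val i with
  | 0%N => exists p m, P = tmon n m * toloc p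
  | 1%N => exists p k, P = tmon k n * toloc p
  | _ => exists p k m, P = tmon k m * toloc p /\ (size p)%:Z + k + m <= - n
  end.

Definition pl0 : 'I_3 := ord0.
Definition pl1 : 'I_3 := Ordinal (isT : 1 < 3)%N.
Definition ploo : 'I_3 := ord_max.

Lemma ord3P (T : 'I_3 -> Prop) : T pl0 -> T pl1 -> T ploo -> forall i, T i.
Proof.
move=> h0 h1 h2 [[|[|[|//]]] lti].
- by rewrite (_ : Ordinal _ = pl0) //; apply: val_inj.
- by rewrite (_ : Ordinal _ = pl1) //; apply: val_inj.
- by rewrite (_ : Ordinal _ = ploo) //; apply: val_inj.
Qed.

Lemma sum3 (T : nmodType) (f : 'I_3 -> T) : \sum_i f i = f pl0 + f pl1 + f ploo.
Proof.
rewrite !big_ord_recl big_ord0 addr0 addrA.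
by congr (_ + f _ + f _); apply: val_inj.
Qed.

(** In this form several elements can be given the same exponents. *)
Lemma fil0P n P : fil pl0 n P <->
  exists M, forall m, m <= M -> exists p, P = tmon n m * toloc p.
Proof.
split=> [[p [m ->]]|[M /(_ M (lexx _)) [p ->]]]; last by exists p, M.
by exists m => m' mm'; rewrite (tmon_lower p (lexx n) mm'); eexists.
Qed.

Lemma fil1P n P : fil pl1 n P <->
  exists K, forall k, k <= K -> exists p, P = tmon k n * toloc p.
Proof.
split=> [[p [k ->]]|[K /(_ K (lexx _)) [p ->]]]; last by exists p, K.
by exists k => k' kk'; rewrite (tmon_lower p kk' (lexx n)); eexists.
Qed.

Lemma fil2P n P : fil ploo n P <->
  exists K M, forall k m, k <= K -> m <= M ->
    exists2 p, P = tmon k m * toloc p & (size p)%:Z <= - n - k - m.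
Proof.
split=> [[p [k [m [-> s]]]]|[K [M /(_ K M (lexx _) (lexx _)) [p -> s]]]]; last first.
  by exists p, K, M; split=> //; lia.
exists (Num.min k (- n - m)), m => k' m' kk' mm'.
have kk : k' <= k by lia.
exists (p * den (`|k - k'|%N, `|m - m'|%N)); first exact: tmon_lower.
have [->|p0] := eqVneq p 0; last first.
  by rewrite size_mul_den //=; move: (size p) s => z s; lia.
by rewrite mul0r size_poly0; lia.
Qed.

(** The levels of the three vertices attached to a matrix with upper left entry
    t^k (t+1)^m; multiplication by that monomial shifts the filtrations by
    them. *)
Definition levels k m (i : 'I_3) : int :=
  match val i with 0%N => k | 1%N => m | _ => - k - m end.

Lemma fil_shift i n P k m : fil i n P -> fil i (n + levels k m i) (tmon k m * P).
Proof.
elim/ord3P: i; rewrite /levels /=.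
- by case=> p [m' ->]; exists p, (m' + m); rewrite tmonMA; congr (tmon _ _ * _); lia.
- by case=> p [k' ->]; exists p, (k' + k); rewrite tmonMA; congr (tmon _ _ * _); lia.
case=> p [k' [m' [-> s]]]; exists p, (k' + k), (m' + m); split; last by lia.
by rewrite tmonMA; congr (tmon _ _ * _); lia.
Qed.

Lemma fil_0 i n : fil i n 0.
Proof.
elim/ord3P: i; [exists 0, 0|exists 0, 0|exists 0, (- n), 0; split];
  by rewrite ?rmorph0 ?mulr0 // size_poly0 add0r addr0.
Qed.

Lemma fil_B i n P Q : fil i n P -> fil i n Q -> fil i n (P - Q).
Proof.
elim/ord3P: i.
- move=> /fil0P[M HM] /fil0P[N HN].
  have [p ->] := HM (Num.min M N) ltac:(lia); have [r ->] := HN (Num.min M N) ltac:(lia).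
  by rewrite -mulrBr -rmorphB; eexists; eexists.
- move=> /fil1P[M HM] /fil1P[N HN].
  have [p ->] := HM (Num.min M N) ltac:(lia); have [r ->] := HN (Num.min M N) ltac:(lia).
  by rewrite -mulrBr -rmorphB; eexists; eexists.
move=> /fil2P[K [M HM]] /fil2P[L [N HN]].
have [p -> sp] := HM (Num.min K L) (Num.min M N) ltac:(lia) ltac:(lia).
have [r -> sr] := HN (Num.min K L) (Num.min M N) ltac:(lia) ltac:(lia).
rewrite -mulrBr -rmorphB /=; do 3 eexists; split; first by [].
have := size_polyD p (- r); rewrite size_polyN.
move: (size p) (size r) (size (p - r)) sp sr => a b c; lia.
Qed.

Lemma fil_N i n P : fil i n P -> fil i n (- P).
Proof. by move=> h; rewrite -sub0r; apply: fil_B => //; apply: fil_0. Qed.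

Lemma fil_D i n P Q : fil i n P -> fil i n Q -> fil i n (P + Q).
Proof. by move=> h h'; rewrite -[Q]opprK; apply: fil_B => //; apply: fil_N. Qed.

Lemma fil_decr i n P : fil i (n + 1) P -> fil i n P.
Proof.
elim/ord3P: i.
- case=> p [m ->]; have n1 : n <= n + 1 by lia.
  by rewrite (tmon_lower p n1 (lexx m)); eexists; eexists.
- case=> p [m ->]; have n1 : n <= n + 1 by lia.
  by rewrite (tmon_lower p (lexx m) n1); eexists; eexists.
by case=> p [k [m [-> s]]]; exists p, k, m; split=> //; lia.
Qed.

Lemma fil_le i n m P : m <= n -> fil i n P -> fil i m P.
Proof.
move=> mn; have [k ->] : exists k : nat, n = m + k%:Z by exists `|n - m|%N; lia.
elim: k => [|k IH]; first by rewrite addr0.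
by move=> h; apply/IH/fil_decr; have -> : m + k%:Z + 1 = m + k.+1%:Z by lia.
Qed.

Lemma loc_tmon P : exists p (a b : nat), P = tmon (- a%:Z) (- b%:Z) * toloc p.
Proof.
have [p [a [b ->]]] := locP P; exists p, a, b.
by rewrite /tmon -!exprnN invrM ?unitrX ?tvar_unit ?tvar1_unit // [LHS]mulrC [X in X * _]mulrC.
Qed.

Lemma fil_exh i P : exists n, fil i n P.
Proof.
have [p [a [b ->]]] := loc_tmon P; elim/ord3P: i.
- by exists (- a%:Z), p, (- b%:Z).
- by exists (- b%:Z), p, (- a%:Z).
by exists (a%:Z + b%:Z - (size p)%:Z), p, (- a%:Z), (- b%:Z); split=> //; lia.
Qed.

Lemma bezout_X_X1 (a b : nat) : exists u v : {poly 'Z_q},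
  u * 'X^a + v * ('X + 1) ^+ b = 1.
Proof. by apply: (@bezout_exp _ 'X ('X + 1) (-1) 1); ring. Qed.

(** Multiplied by a power of t, and also by a power of t + 1, the quotient
    P / (t^k (t+1)^m) becomes a polynomial; a Bezout relation between the two
    powers shows that it is one itself. Its size is then bounded by the
    condition at infinity. *)
Lemma fil_cap k m n P : 0 <= - n - k - m ->
  fil pl0 k P -> fil pl1 m P -> fil ploo n P ->
  exists2 p, P = tmon k m * toloc p & (size p)%:Z <= - n - k - m.
Proof.
move=> pos /fil0P[M H0] /fil1P[K H1] /fil2P[K' [M' H2]].
have [p0 P0] := H0 (Num.min M m) ltac:(lia).
have [p1 P1] := H1 (Num.min K k) ltac:(lia).
have [a ka] : exists a : nat, k - a%:Z = Num.min K k by exists `|k - Num.min K k|%N; lia.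
have [b mb] : exists b : nat, m - b%:Z = Num.min M m by exists `|m - Num.min M m|%N; lia.
rewrite -ka in P1; rewrite -mb in P0.
have [u [v uv]] := bezout_X_X1 a b.
have Pp : P = tmon k m * toloc (u * p1 + v * p0).
  have E1 : toloc ('X^a) * P = tmon k m * toloc p1.
    have -> : 'X^a = den (a, 0)%N by rewrite /den mulr1.
    by rewrite P1 -tmon_den tmonMA; congr (tmon _ _ * _); lia.
  have E0 : toloc (('X + 1) ^+ b) * P = tmon k m * toloc p0.
    have -> : ('X + 1) ^+ b = den (0, b)%N by rewrite /den mul1r.
    by rewrite P0 -tmon_den tmonMA; congr (tmon _ _ * _); lia.
  rewrite -[LHS]mul1r -[1](rmorph1 (@toloc q)) -uv !rmorphD !rmorphM /=.
  rewrite mulrDl -(mulrA (toloc u)) -(mulrA (toloc v)) E1 E0.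
  by rewrite mulrDr; congr (_ + _); apply: mulrCA.
exists (u * p1 + v * p0) => //; move: (_ + _) Pp => p Pp {uv}.
have [->|p_neq0] := eqVneq p 0; first by rewrite size_poly0.
have hk : Num.min K' k <= k by lia.
have hm : Num.min M' m <= m by lia.
have [r Pr sr] := H2 (Num.min K' k) (Num.min M' m) ltac:(lia) ltac:(lia).
move: Pp; rewrite Pr (tmon_lower p hk hm) => /toloc_tmonI rE.
by move: sr; rewrite rE size_mul_den //=; move: (size p) => z; lia.
Qed.

(** The component [f i] has its poles only at the place i. *)
Lemma partial_fractions F : exists f : 'I_3 -> R,
  F = f pl0 + f pl1 + f ploo /\ forall i j, i != j -> fil j 0 (f i).
Proof.
have [p [a [b ->]]] := loc_tmon F.
have [u [v uv]] := bezout_X_X1 a b.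
have E : tmon (- a%:Z) (- b%:Z) * toloc p =
    tmon 0 (- b%:Z) * toloc (p * u) + tmon (- a%:Z) 0 * toloc (p * v).
  have {1}-> : p = p * u * den (a, 0)%N + p * v * den (0, b)%N.
    by rewrite /den /= mulr1 mul1r -!mulrA -mulrDr uv mulr1.
  rewrite rmorphD /= !toloc_denM mulrDr !tmonMA.
  by congr (tmon _ _ * _ + tmon _ _ * _); lia.
have [md1 md0] := (den_monic (0, b)%N, den_monic (a, 0)%N).
have := Pdiv.CommonRing.ltn_rmodp (p * u) (den (0, b)%N).
have := Pdiv.CommonRing.ltn_rmodp (p * v) (den (a, 0)%N).
rewrite !monic_neq0 // !size_den /= !ltnS.
move: (Pdiv.RingMonic.rdivp_eq md1 (p * u)) (Pdiv.RingMonic.rdivp_eq md0 (p * v)).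
move: (Pdiv.CommonRing.rdivp _ _) (Pdiv.CommonRing.rmodp _ _) => d1 r1 E1.
move: (Pdiv.CommonRing.rdivp _ _) (Pdiv.CommonRing.rmodp _ _) => d0 r0 E0 s0 s1.
pose f (i : 'I_3) := if i == pl0 then tmon (- a%:Z) 0 * toloc r0
  else if i == pl1 then tmon 0 (- b%:Z) * toloc r1 else tmon 0 0 * toloc (d0 + d1).
exists f; split.
  rewrite /f /= E E1 E0 !rmorphD /= !toloc_denM !mulrDr !tmonMA.
  by rewrite !addNr !addr0 addrC addrACA addrC.
elim/ord3P; elim/ord3P => // _; rewrite /f /=.
- by exists r0, (- a%:Z).
- by exists r0, (- a%:Z), 0; split=> //; move: (size _) s0 => z; lia.
- by exists r1, (- b%:Z).
- by exists r1, 0, (- b%:Z); split=> //; move: (size _) s1 => z; lia.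
- by exists (d0 + d1), 0.
by exists (d0 + d1), 0.
Qed.

(** After dividing by the monomial of levels n, all levels are 0; the answer
    then adds up, over the places i, the part of F i with poles at i. *)
Lemma approximation (n : 'I_3 -> int) (F : 'I_3 -> R) :
  \sum_i n i = 0 -> exists P, forall i, fil i (n i) (P - F i).
Proof.
rewrite sum3 => n0; set k := n pl0; set m := n pl1.
have nE i : n i = levels k m i by elim/ord3P: i => //=; rewrite /levels /= /k /m; lia.
have /choice[f Hf] i := partial_fractions (tmon (- k) (- m) * F i).
exists (tmon k m * \sum_i f i i) => i.
have -> : F i = tmon k m * (tmon (- k) (- m) * F i).
  by rewrite tmonMA !addrN tmon0 mul1r.
have [-> Hi] := Hf i; rewrite -mulrBr -[n i]add0r nE; apply: fil_shift.
rewrite -sum3 -sumrB; apply: big_ind => [||j _]; [exact: fil_0|exact: fil_D|].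
have [->|ij] := eqVneq j i; first by rewrite subrr; apply: fil_0.
by apply: fil_B; [have [_ /(_ j i ij)] := Hf j|apply: Hi].
Qed.

Lemma fil_cap0 (n : 'I_3 -> int) P : \sum_i n i = 0 ->
  (forall i, fil i (n i) P) -> P = 0.
Proof.
rewrite sum3 => n0 H.
have [||||p -> sp] := @fil_cap (n pl0) (n pl1) (n ploo) P => //; first by lia.
suff -> : p = 0 by rewrite rmorph0 mulr0.
by apply/eqP; rewrite -size_poly_eq0; move: (size p) sp => z; lia.
Qed.

(** The quotient of P by the monomial is a polynomial of size at most 1. *)
Lemma fil_cap1 (n : 'I_3 -> int) P : \sum_i n i = -1 ->
  (forall i, fil i (n i) P) <-> exists b, P = lconst b * tmon (n pl0) (n pl1).
Proof.
rewrite sum3 => n0; split=> [H|[b ->]].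
  have [||||p -> sp] := @fil_cap (n pl0) (n pl1) (n ploo) P => //; first by lia.
  have /size1_polyC -> : (size p <= 1)%N by move: (size p) sp => z; lia.
  by exists p`_0; rewrite mulrC.
rewrite mulrC; elim/ord3P.
- by exists b%:P, (n pl1).
- by exists b%:P, (n pl0).
exists b%:P, (n pl0), (n pl1); split=> //.
by have := size_polyC_leq1 b; move: (size _) => z; lia.
Qed.

Lemma lconst_tmon_eq0 b k m : lconst b * tmon k m = 0 -> b = 0.
Proof.
move=> E; apply: polyC_inj; rewrite polyC0; apply: (@toloc_tmonI k m).
by rewrite rmorph0 mulr0 mulrC.
Qed.

(** If t^a (t+1)^b = 1, the valuations of 1 are at least those of both exponent
    vectors (a, b) and (0, 0); unless a = b = 0, the maxima of the levels have a
    sum at least 0, which forces 1 = 0 by [fil_cap0]. *)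
Lemma tmon_inj k m k' m' : tmon k m = tmon k' m' -> (k, m) = (k', m').
Proof.
suff H a b : tmon a b = 1 -> a = 0 /\ b = 0.
  move=> E; have [|a0 b0] := H (k - k') (m - m').
    by rewrite tmonD E -tmonD !addrN tmon0.
  by congr pair; lia.
have in1 c d : tmon c d = 1 ->
    [/\ fil pl0 c 1, fil pl1 d 1 & fil ploo (- c - d - 1) 1].
  move=> E; split; [exists 1, d|exists 1, c|exists 1, c, d; split];
    rewrite ?rmorph1 ?mulr1 ?E // size_poly1; lia.
move=> /in1[a0 b1 c2]; have [z0 z1 z2] := in1 0 0 (tmon0 q).
case: (pselect (a = 0 /\ b = 0)) => // ab0.
have /eqP := oner_neq0 R; case.
apply: (@fil_cap0 (levels (Num.max 0 a) (Num.max 0 b))).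
  by rewrite sum3 /levels /=; lia.
elim/ord3P; rewrite /levels /=.
- by case: (leP 0 a).
- by case: (leP 0 b).
have [h|h] := leP 0 (- a - b - 1); first by apply: fil_le c2; lia.
by apply: fil_le z2; lia.
Qed.

(** A vector of levels with i-th entry n and sum -1, so that [fil_cap1] produces
    the digits at level n of the place i. *)
Definition pad (i : 'I_3) (n : int) (j : 'I_3) : int :=
  if j == i then n
  else if j == (if i == ploo then pl0 else ploo) then - n - 1 else 0.

Lemma sum_pad i n : \sum_j pad i n j = -1.
Proof. by elim/ord3P: i; rewrite sum3 /pad /=; lia. Qed.

Definition digit i n (b : 'Z_q) : R :=
  lconst b * tmon (pad i n pl0) (pad i n pl1).

Lemma lconst0 : lconst (0 : 'Z_q) = 0.
Proof. by rewrite /lconst polyC0 rmorph0. Qed.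

Lemma lconstB (b c : 'Z_q) : lconst (b - c) = lconst b - lconst c.
Proof. by rewrite /lconst polyCB rmorphB. Qed.

Lemma digit0 i n : digit i n 0 = 0.
Proof. by rewrite /digit lconst0 mul0r. Qed.

Lemma digitP i n P :
  (forall j, fil j (pad i n j) P) <-> exists b, P = digit i n b.
Proof. exact: fil_cap1 (sum_pad i n). Qed.

Lemma fil_digit i n b : fil i n (digit i n b).
Proof.
have /digitP/(_ i) : exists c, digit i n b = digit i n c by exists b.
by rewrite /pad eqxx.
Qed.

Lemma sum_pad1 i n : \sum_j (if j == i then n + 1 else pad i n j) = 0.
Proof. by elim/ord3P: i; rewrite sum3 /pad /=; lia. Qed.

(** Approximate P to order n + 1 at i while keeping the padded levels at the
    other places: the result lies in all the padded filtrations, so it is a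
    digit. *)
Lemma digit_surj i n P : fil i n P -> exists b, fil i (n + 1) (P - digit i n b).
Proof.
move=> iP.
have [Q HQ] := approximation (fun j => if j == i then P else 0) (sum_pad1 i n).
have /digitP[b Qb] : forall j, fil j (pad i n j) Q.
  move=> j; have := HQ j; case: eqVneq => [->|ji]; last by rewrite subr0.
  by move/fil_decr/fil_D/(_ iP); rewrite subrK /pad eqxx.
by exists b; rewrite -Qb -opprB; apply: fil_N; have := HQ i; rewrite eqxx.
Qed.

Lemma digit_inj i n b c : fil i (n + 1) (digit i n b - digit i n c) -> b = c.
Proof.
have E : digit i n b - digit i n c = digit i n (b - c).
  by rewrite /digit lconstB mulrBl.
rewrite E => iP; apply: subr0_eq; apply: lconst_tmon_eq0.
apply: (fil_cap0 (sum_pad1 i n)) => j.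
by case: eqVneq => [->|_]; [exact: iP|move: j; apply/digitP; exists (b - c)].
Qed.

End Filtrations.

(** * The affine group and its generators *)

Section Group.

Variable q : nat.
Local Notation R := (loc q).
Local Notation tmon := (tmon q).
Implicit Types (P Q : R) (k m : int).

Lemma aff_subproof k m P : in_Gamma3 (affmx (tmon k m) P).
Proof. by apply/asboolP; exists k, m, P. Qed.

Definition aff k m P : Gamma3 q := Sub _ (aff_subproof k m P).

Lemma affP (g : Gamma3 q) : exists k m P, g = aff k m P.
Proof.
have /asboolP[k [m [P E]]] := valP g.
by exists k, m, P; apply: val_inj.
Qed.

Lemma affmx_inj (a b c d : R) : affmx a b = affmx c d -> a = c /\ b = d.
Proof.
by move/matrixP=> E; split; [have := E 0 0|have := E 0 1]; rewrite !mxE.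
Qed.

Lemma aff_inj k m P k' m' P' :
  aff k m P = aff k' m' P' -> [/\ k = k', m = m' & P = P'].
Proof. by move/(congr1 val)/affmx_inj => [/tmon_inj[-> ->] ->]. Qed.

Lemma affM k m P k' m' P' :
  (aff k m P * aff k' m' P')%g = aff (k + k') (m + m') (tmon k m * P' + P).
Proof. by apply: val_inj; rewrite /= affmxM tmonD. Qed.

Lemma aff1 : aff 0 0 0 = 1%g.
Proof. by apply: val_inj; rewrite /= tmon0 affmx1. Qed.

Lemma tmon_pred k m : tmon (k - 1) m = tmon k m * tvar^-1.
Proof.
by rewrite -[m in LHS]addr0 tmonD /Defs.tmon exprN1 expr0z mulr1.
Qed.

Lemma basic_gensP (g : Gamma3 q) : Gamma3_basic_gens g <-> exists b,
  [\/ g = aff 1 0 (lconst b), g = aff 0 1 (lconst b)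
    | g = aff (-1) 1 (- (lconst b * tvar^-1))].
Proof.
have E1 : tmon 1 0 = tvar by rewrite /tmon expr0z mulr1.
have E2 : tmon 0 1 = tvar + 1 by rewrite /tmon expr0z mul1r.
have E3 : tmon (-1) 1 = tvar^-1 + 1.
  by rewrite /tmon exprN1 mulrDr mulr1 mulVr ?tvar_unit // addrC.
split=> -[b H]; exists b.
  by case: H => E; [apply: Or31|apply: Or32|apply: Or33]; apply: val_inj;
    rewrite E /= ?E1 ?E2 ?E3.
by case: H => ->; [apply: Or31|apply: Or32|apply: Or33]; rewrite /= ?E1 ?E2 ?E3.
Qed.

(** The pairs (i, j) of places for which moving down in the tree i and up in the
    tree j is right multiplication by a generator; one pair out of each two
    opposite ones, in the order of the three families of generators. *)
Definition arcs : seq ('I_3 * 'I_3) := [:: (pl0, ploo); (pl1, ploo); (pl1, pl0)].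

(** The generators are characterized by valuations alone: the levels change at i
    and j, and P changes by an element of the filtrations with the level at j
    lowered by one. These levels sum to -1, so [fil_cap1] turns the condition
    into q explicit values. *)
Lemma basic_arc k m P k' m' P' :
  Gamma3_basic_gens ((aff k m P)^-1 * aff k' m' P')%g <->
  exists i j, [/\ (i, j) \in arcs,
    forall l, levels k' m' l = levels k m l + (l == i)%:R - (l == j)%:R
    & forall l, fil l (levels k m l - (l == j)%:R) (P' - P)].
Proof.
have sol (g h s : Gamma3 q) : (g^-1 * h)%g = s <-> h = (g * s)%g.
  by split=> [<-|->]; rewrite ?mulVKg ?mulKg.
have lvl j : \sum_l (levels k m l - (l == j)%:R) = -1.
  by elim/ord3P: j; rewrite sum3 /levels /=; lia.
split.
  case/basic_gensP=> b [] /sol; rewrite affM => /aff_inj[-> -> ->].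
  - exists pl0, ploo; split=> // [|]; first by elim/ord3P; rewrite /levels /=; lia.
    apply/fil_cap1 => //; exists b.
    by rewrite /levels /= !subr0 addrK mulrC.
  - exists pl1, ploo; split=> // [|]; first by elim/ord3P; rewrite /levels /=; lia.
    apply/fil_cap1 => //; exists b.
    by rewrite /levels /= !subr0 addrK mulrC.
  exists pl1, pl0; split=> // [|]; first by elim/ord3P; rewrite /levels /=; lia.
  apply/fil_cap1 => //; exists (- b).
  rewrite -[- b]sub0r lconstB lconst0 sub0r /levels /= subr0 addrK tmon_pred.
  by rewrite mulrN mulNr mulrCA.
move=> [i [j [ij lev /fil_cap1 [//|b Pb]]]].
have [levk levm] := (lev pl0, lev pl1).
move: ij Pb levk levm; rewrite !inE => /or3P[]/eqP[-> ->];
  rewrite /levels /= ?subr0 ?addr0 => /(canRL (subrK P)) -> -> ->; apply/basic_gensP.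
- exists b; apply: Or31; apply/sol; rewrite affM.
  by congr aff; rewrite ?addr0 // mulrC.
- exists b; apply: Or32; apply/sol; rewrite affM.
  by congr aff; rewrite ?addr0 // mulrC.
exists (- b); apply: Or33; apply/sol; rewrite affM.
rewrite -[- b]sub0r lconstB lconst0 sub0r tmon_pred; congr aff; rewrite ?addr0 //.
by rewrite mulNr opprK mulrCA.
Qed.

Local Notation gens := (@Gamma3_gens q).

Lemma gensV g : gens g -> gens g^-1%g.
Proof. by case=> h; [right; rewrite invgK|left]. Qed.

Lemma finite_gens : finite_set gens.
Proof.
have Fb : finite_set (@Gamma3_basic_gens q).
  pose f (b : 'Z_q) := aff 1 0 (lconst b); pose g (b : 'Z_q) := aff 0 1 (lconst b).
  pose h (b : 'Z_q) := aff (-1) 1 (- (lconst b * tvar^-1)).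
  apply: (@sub_finite_set _ _ (range f `|` range g `|` range h)%classic).
    move=> x /basic_gensP[b [] ->]; [left; left|left; right|right]; by exists b.
  by rewrite !finite_setU; do !split; apply: finite_image; apply: finite_finset.
have -> : gens = (@Gamma3_basic_gens q `|`
    (fun g => g^-1)%g @^-1` @Gamma3_basic_gens q)%classic by [].
rewrite finite_setU; split=> //; apply: finite_preimage => // x y _ _ /invg_inj //.
Qed.

Definition generated (g : Gamma3 q) := exists2 s : seq (Gamma3 q),
  (forall x, x \in s -> gens x) & g = (\prod_(x <- s) x)%g.

Lemma generated_gen g : gens g -> generated g.
Proof.
by move=> h; exists [:: g]; [move=> x; rewrite inE => /eqP->|rewrite big_seq1].
Qed.

Lemma generated1 : generated 1%g.
Proof. by exists [::]; rewrite ?big_nil. Qed.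

Lemma generatedM g h : generated g -> generated h -> generated (g * h)%g.
Proof.
move=> [s Hs ->] [r Hr ->]; exists (s ++ r); last by rewrite big_cat.
by move=> x; rewrite mem_cat => /orP[/Hs|/Hr].
Qed.

Lemma generatedV g : generated g -> generated g^-1%g.
Proof.
case=> s Hs ->; elim: s Hs => [|x s IH] Hs.
  by rewrite big_nil invg1; apply: generated1.
rewrite big_cons invgM; apply: generatedM.
  by apply: IH => y ys; apply: Hs; rewrite inE ys orbT.
by apply/generated_gen/gensV/Hs/mem_head.
Qed.

Lemma generated_expz (f : int -> Gamma3 q) :
  (forall a b, f (a + b) = (f a * f b)%g) -> generated (f 1) -> forall n, generated (f n).
Proof.
move=> fD f1; have f0 : f 0 = 1%g.
  by apply: (@mulgI _ (f 0)); rewrite -fD addr0 mulg1.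
have fn (n : nat) : generated (f n).
  elim: n => [|n IH]; first by rewrite f0; apply: generated1.
  by rewrite -addn1 PoszD fD; apply: generatedM.
case=> n; first exact: fn.
have -> : f (Negz n) = ((f n.+1)^-1)%g; last exact/generatedV/fn.
by apply: (@mulIg _ (f n.+1)); rewrite -fD mulVg NegzE addNr.
Qed.

(** The generators with b = 0 give all diagonal matrices; the quotients of
    generators of the first family give the translations by constants, hence
    by conjugation the translations by b t^k (t+1)^m, which add up to all
    translations. *)
Lemma gens_generate : generates gens.
Proof.
move=> g; rewrite -/(generated g).
have basic h : Gamma3_basic_gens h -> generated h.
  by move=> hb; apply: generated_gen; left.
have diag k m : generated (aff k m 0).
  have -> : aff k m 0 = (aff k 0 0 * aff 0 m 0)%g.
    by rewrite affM mulr0 !addr0 add0r.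
  apply: generatedM.
    apply: (@generated_expz (fun k => aff k 0 0)) => [a b|]; first by rewrite affM mulr0 !addr0.
    by apply/basic/basic_gensP; exists 0; apply: Or31; rewrite lconst0.
  apply: (@generated_expz (fun k => aff 0 k 0)) => [a b|]; first by rewrite affM mulr0 !addr0.
  by apply/basic/basic_gensP; exists 0; apply: Or32; rewrite lconst0.
have const b : generated (aff 0 0 (lconst b)).
  have -> : aff 0 0 (lconst b) = (aff 1 0 (lconst b) * (aff (-1) 0 0))%g.
    by rewrite affM mulr0 !add0r subrr.
  by apply: generatedM => //; apply/basic/basic_gensP; exists b; apply: Or31.
have mono b k m : generated (aff 0 0 (tmon k m * lconst b)).
  have -> : aff 0 0 (tmon k m * lconst b) =
      (aff k m 0 * (aff 0 0 (lconst b) * aff (- k) (- m) 0))%g.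
    by rewrite !affM mulr0 !add0r !addr0 !addrN.
  by apply: generatedM => //; apply: generatedM.
have trans P : generated (aff 0 0 P).
  have [p [a [b ->]]] := loc_tmon P.
  rewrite -[p]coefK poly_def rmorph_sum mulr_sumr /=.
  apply: (big_ind (fun P => generated (aff 0 0 P))) => [|x y hx hy|i _].
  - by rewrite aff1; apply: generated1.
  - have -> : aff 0 0 (x + y) = (aff 0 0 y * aff 0 0 x)%g by rewrite affM tmon0 mul1r !addr0.
    exact: generatedM.
  rewrite -mul_polyC.
  have -> : 'X^i = den q (i : nat, 0)%N by rewrite /den mulr1.
  by rewrite toloc_denM tmonMA; apply: mono.
have [k [m [P ->]]] := affP g.
have -> : aff k m P = (aff 0 0 P * aff k m 0)%g by rewrite affM mulr0 !add0r.
exact: generatedM.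
Qed.

Lemma gens_sym_gen_set : sym_gen_set gens.
Proof.
split; [exact: finite_gens| |exact: gens_generate].
by move=> x; split=> [/gensV//|/gensV]; rewrite invgK.
Qed.

End Group.

(** * Triples of vertices as affine matrices *)

(** The function [ball i] attaches to each vertex, seen in the i-th tree, a coset
    of the i-th filtration. *)
Section Coding.

Variables (q : nat) (V : choiceType) (e : rel V) (o : V) (w : set (nat -> V)).
Local Notation R := (loc q).
Local Notation lev := (busemann e o w).
Local Notation X := (DL3_vertex e o w).

Variables (par : V -> V) (ball : 'I_3 -> V -> R -> Prop).
Hypothesis edge_par : forall x y, e x y = (par x == y) || (par y == x).
Hypothesis lev_par : forall x, lev (par x) = lev x - 1.
Hypothesis ball_coset : forall i x P Q, ball i x P -> ball i x Q <-> fil i (lev x) (P - Q).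
Hypothesis ball_par : forall i x P, ball i x P -> ball i (par x) P.
Hypothesis ball_inj : forall i x y P, lev x = lev y -> ball i x P -> ball i y P -> x = y.
Hypothesis ball_ex : forall i n P, exists2 x, lev x = n & ball i x P.
Hypothesis ball_nonempty : forall i x, exists P, ball i x P.

Implicit Types (x y : X) (k m : int) (P : R).

Definition code x k m P :=
  forall i, lev (val x i) = levels k m i /\ ball i (val x i) P.

Lemma sum_levels k m : \sum_i levels k m i = 0.
Proof. by rewrite sum3 /levels /=; lia. Qed.

Lemma code_total x : exists k m P, code x k m P.
Proof.
have /eqP lx := valP x; have /choice[F HF] i := ball_nonempty i (val x i).
have [P HP] := approximation F lx.
exists (lev (val x pl0)), (lev (val x pl1)), P => i; split.
  by move: lx; rewrite sum3; elim/ord3P: i; rewrite /levels /=; lia.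
by apply/(ball_coset _ (HF i)); rewrite -opprB; apply: fil_N.
Qed.

Lemma code_surj k m P : exists x, code x k m P.
Proof.
have H i : exists v, lev v = levels k m i /\ ball i v P.
  by have [v lv bv] := ball_ex i (levels k m i) P; exists v.
have [f Hf] := choice H.
have fP : \sum_i lev ([ffun i => f i] i) == 0.
  apply/eqP; rewrite -[RHS](sum_levels k m).
  by apply: eq_bigr => i _; rewrite ffunE; have [] := Hf i.
exists (exist (fun x : {ffun 'I_3 -> V} => \sum_i lev (x i) == 0) _ fP) => i.
by rewrite /= ffunE.
Qed.

Lemma code_fun x k m P k' m' P' :
  code x k m P -> code x k' m' P' -> [/\ k = k', m = m' & P = P'].
Proof.
move=> c c'; have [[l0 _] [l1 _]] := (c pl0, c pl1); have [[l0' _] [l1' _]] := (c' pl0, c' pl1).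
have kk : k = k' by rewrite -[LHS]/(levels k m pl0) -l0 l0'.
have mm : m = m' by rewrite -[LHS]/(levels k m pl1) -l1 l1'.
split=> //; apply: subr0_eq; apply: (fil_cap0 (sum_levels k m)) => i.
have [<- bP] := c i; have [_ bP'] := c' i.
by apply/(ball_coset _ bP).
Qed.

Lemma code_inj x y k m P : code x k m P -> code y k m P -> x = y.
Proof.
move=> cx cy; apply/val_inj/ffunP => i.
have [lx bx] := cx i; have [ly by_] := cy i.
by apply: (ball_inj _ bx by_); rewrite lx ly.
Qed.

(** The coordinate i moves to a child and the coordinate j to the parent. *)
Definition step (i j : 'I_3) x y :=
  [/\ par (val y i) = val x i, val y j = par (val x j)
    & forall l, l != i -> l != j -> val y l = val x l].

(** At equal levels, a vertex is determined by one element of its ball, so each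
    of the three conditions on the coordinates becomes a congruence between P
    and P'. *)
Lemma step_code i j x y k m P k' m' P' : i != j ->
  code x k m P -> code y k' m' P' ->
  step i j x y <->
  (forall l, levels k' m' l = levels k m l + (l == i)%:R - (l == j)%:R) /\
  (forall l, fil l (levels k m l - (l == j)%:R) (P' - P)).
Proof.
move=> ij cx cy; have ji : (j == i) = false by rewrite eq_sym (negbTE ij).
split=> [[si sj sl]|[Hlev Hfil]].
  have lvl l : levels k' m' l = levels k m l + (l == i)%:R - (l == j)%:R.
    have [<- _] := cx l; have [<- _] := cy l.
    have [->|li] := eqVneq l i.
      by rewrite (negbTE ij) -si lev_par; lia.
    have [->|lj] := eqVneq l j; first by rewrite sj lev_par; lia.
    by rewrite sl //; lia.
  split=> // l; have [lx bx] := cx l; have [ly by_] := cy l.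
  have [li|li] := eqVneq l i.
    subst l; rewrite (negbTE ij) subr0 -lx -si; apply/ball_coset; first exact: ball_par.
    by rewrite si.
  have [lj|lj] := eqVneq l j.
    subst l; rewrite -lx -lev_par -sj; apply/ball_coset; first by [].
    by rewrite sj; apply: ball_par.
  by rewrite subr0 -lx -sl //; apply/ball_coset => //; rewrite sl.
have par_ball l : ball l (if l == j then par (val x l) else val x l) P'.
  have [lx bx] := cx l; have := fil_N (Hfil l); rewrite opprB.
  case: eqVneq => _ h; last by apply/(ball_coset _ bx); rewrite lx -[levels _ _ _]subr0.
  by apply/(ball_coset _ (ball_par bx)); rewrite lev_par lx.
split.
- have [lx bx] := cx i; have [ly by_] := cy i.
  apply: (@ball_inj i _ _ P') (ball_par by_) _; last by have := par_ball i; rewrite (negbTE ij).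
  by rewrite lev_par ly lx Hlev eqxx (negbTE ij) /=; lia.
- have [lx bx] := cx j; have [ly by_] := cy j.
  apply: (@ball_inj j _ _ P') by_ _; last by have := par_ball j; rewrite eqxx.
  by rewrite lev_par ly lx Hlev eqxx ji; lia.
move=> l li lj; have [lx bx] := cx l; have [ly by_] := cy l.
apply: (@ball_inj l _ _ P') by_ _; last by have := par_ball l; rewrite (negbTE lj).
by rewrite ly lx Hlev (negbTE li) (negbTE lj); lia.
Qed.

(** The levels of each vertex sum to 0, so the two coordinates that change along
    an edge move in opposite directions. *)
Lemma DL3_step x y : DL3 x y <->
  exists i j, (i, j) \in arcs /\ (step i j x y \/ step i j y x).
Proof.
split=> [/existsP[i /existsP[j /and4P[ij exi exj /forallP H]]]|].
  have {}H l : l != i -> l != j -> val y l = val x l.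
    by move=> li lj; have := H l; rewrite li lj /= => /eqP.
  have stepP : step i j x y \/ step j i x y.
    have sxy : \sum_l lev (val y l) = \sum_l lev (val x l).
      exact: etrans (eqP (valP y)) (esym (eqP (valP x))).
    have lev_ij : lev (val y i) + lev (val y j) = lev (val x i) + lev (val x j).
      have ji : j != i by rewrite eq_sym.
      move: sxy.
      rewrite (bigD1 i) // (bigD1 j) //=.
      rewrite [X in _ = X -> _](bigD1 i) // [in X in _ = X -> _](bigD1 j) //= !addrA.
      rewrite (eq_bigr (fun l => lev (val x l))); first by move/addIr.
      by move=> l /andP[li lj]; rewrite H.
    move: exi exj; rewrite !edge_par => /orP[]/eqP Ei /orP[]/eqP Ej.
    - by exfalso; move: lev_ij; rewrite -Ei -Ej !lev_par; lia.
    - by right; split=> // l lj li; apply: H.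
    - by left; split=> // l lj li; apply: H.
    by exfalso; move: lev_ij; rewrite -Ei -Ej !lev_par; lia.
  have rev a b : step a b x y -> step b a y x.
    by case=> sa sb sl; split=> // l lb la; rewrite sl.
  have arcsP : (i, j) \in arcs \/ (j, i) \in arcs.
    by move: ij; clear; elim/ord3P: i; elim/ord3P: j => //= _; rewrite !inE /=; auto.
  case: arcsP => a; [exists i, j|exists j, i]; split=> //.
    by case: stepP => h; [left|right; apply: rev].
  by case: stepP => h; [right; apply: rev|left].
case=> i [j [ij H]].
have {}ij : i != j by move: ij; rewrite !inE => /or3P[]/eqP[-> ->].
apply/existsP; exists i; apply/existsP; exists j; rewrite ij /= !edge_par.
case: H => -[si sj sl]; rewrite si sj !eqxx ?orbT /=; apply/forallP => l;
  by apply/implyP=> /andP[li lj]; rewrite sl.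
Qed.

Lemma DL3_cayley x y k m P k' m' P' : code x k m P -> code y k' m' P' ->
  cayley (@Gamma3_gens q) (aff k m P) (aff k' m' P') = DL3 x y.
Proof.
move=> cx cy.
have arc_neq i j : (i, j) \in arcs -> i != j.
  by rewrite !inE => /or3P[]/eqP[-> ->].
have eg : cayley (@Gamma3_gens q) (aff k m P) (aff k' m' P') <->
    Gamma3_gens ((aff k m P)^-1 * aff k' m' P')%g by rewrite /cayley inE.
apply/idP/idP=> [/eg H|/DL3_step H]; [apply/DL3_step|apply/eg].
  case: H => [/basic_arc|]; [|rewrite invgM invgK => /basic_arc];
    move=> [i [j [ij H1 H2]]]; exists i, j; split=> //; [left|right].
    by apply/(step_code (arc_neq _ _ ij) cx cy).
  by apply/(step_code (arc_neq _ _ ij) cy cx).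
case: H => i [j [ij []]].
  move=> /(step_code (arc_neq _ _ ij) cx cy)[H1 H2].
  by left; apply/basic_arc; exists i, j.
move=> /(step_code (arc_neq _ _ ij) cy cx)[H1 H2].
by right; rewrite invgM invgK; apply/basic_arc; exists i, j.
Qed.

Lemma DL3_iso : graph_iso (DL3 (e := e) (o := o) (w := w)) (cayley (@Gamma3_gens q)).
Proof.
have H x : exists g : Gamma3 q, exists k m P, code x k m P /\ g = aff k m P.
  by have [k [m [P c]]] := code_total x; exists (aff k m P), k, m, P.
have [phi Hphi] := choice H.
have H' g : exists x, phi x = g.
  have [k [m [P ->]]] := affP g; have [x c] := code_surj k m P; exists x.
  have [k' [m' [P' [c' ->]]]] := Hphi x.
  by have [-> -> ->] := code_fun c c'.
have [psi psiK] := choice H'.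
exists phi; last first.
  move=> x y; have [k [m [P [cx ->]]]] := Hphi x; have [k' [m' [P' [cy ->]]]] := Hphi y.
  exact: DL3_cayley.
exists psi => // x.
have [k [m [P [cx ex]]]] := Hphi x; have [k' [m' [P' [cy ey]]]] := Hphi (psi (phi x)).
rewrite psiK ex in ey; have [ek em eP] := aff_inj ey.
by rewrite -ek -em -eP in cy; apply: code_inj cy cx.
Qed.

End Coding.

Theorem mainTheorem5 (q : nat) (hq : (2 <= q)%N)
    (V : choiceType) (e : rel V) (hT : homogeneous_tree e q)
    (o : V) (w : set (nat -> V)) (hw : tree_end e w) :
  sym_gen_set (@Gamma3_gens q) /\
  graph_iso (DL3 (e := e) (o := o) (w := w)) (cayley (@Gamma3_gens q)).
Proof.
split; first exact: gens_sym_gen_set.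
case: hT => -[e_sym e_irr] conn acyc deg.
pose par := parent e_sym e_irr conn acyc hw.
have epar : forall x y, e x y = (par x == y) || (par y == x) by apply: edge_parent.
have parI : injective (fun n => iter n par o) by apply: iter_parent_inj.
have children x : exists s, [/\ uniq s, size s = q & forall y, (y \in s) = (par y == x)].
  have [s [us ss es]] := deg x.
  have xs : par x \in s by rewrite es [_ \in _]epar eqxx.
  exists (rem (par x) s); split; [exact: rem_uniq|by rewrite size_rem // ss|].
  move=> y; rewrite mem_rem_uniq // inE es [y \in e x]epar /= eq_sym.
  case: eqVneq => [<-|_] //=; apply/esym/eqP.
  by move/(@iter_parent_inj _ _ e_sym e_irr conn acyc _ hw x 2 0).
have [lab [labS labI lab0]] := sibling_labels hq parI children.
have lpar := busemann_parent e_sym e_irr conn acyc hw o.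
have com := common_ancestor e_sym e_irr conn acyc hw.
pose B i := ball (busemann e o w) com lab0 (@fil q i) (@digit q i).
apply: (@DL3_iso q V e o w par B epar lpar).
- by move=> i x P Q; apply: ballE; apply: fil_B.
- move=> i x P; apply: ball_par => //; first [exact: fil_0 | exact: fil_B
    | exact: fil_decr | exact: digit0 | exact: fil_digit].
- move=> i x y P; apply: ball_inj => //; first [exact: fil_0 | exact: fil_B
    | exact: fil_decr | exact: digit0 | exact: fil_digit | exact: digit_inj].
- move=> i n P; apply: ball_ex => //; first [exact: fil_0 | exact: fil_B
    | exact: fil_decr | exact: fil_exh | exact: digit0 | exact: digit_surj].
by move=> i x; eexists; apply: ball_center; apply: fil_0.
Qed.
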